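(* Let $\gamma$ be the restriction to $\mathbb S_+^d$ of a norm on $\mathbb S^d$, assumed monotone ($0\preceq S\preceq S'$ implies $\gamma(S)\le\gamma(S')$), and let $\mathcal K_\gamma\subset\mathbb S_+^d$ be any representing set for $\gamma$. Then for every $\mu,\nu\in\mathcal P_2(\mathbb R^d)$, $$\mathsf W_\gamma(\mu,\nu)^2=\max_{Q\in\mathcal K_\gamma}\ \inf_{\pi\in\Pi(\mu,\nu)}\int (y-x)^\top Q(y-x)\,d\pi(x,y)=\max_{Q\in\mathcal K_\gamma}\mathsf W^{Q}(\mu,\nu)^2 .$$ Moreover, writing $\Sigma_\pi=\int (y-x)(y-x)^\top\,d\pi(x,y)$, any saddle point $(Q^\star,\pi^\star)\in\mathcal K_\gamma\times\Pi(\mu,\nu)$ of the functional $(Q,\pi)\mapsto\int (y-x)^\top Q(y-x)\,d\pi(x,y)$ (maximized in $Q\in\mathcal K_\gamma$, minimized in $\pi\in\Pi(\mu,\nu)$) satisfies $Q^\star\in\partial\gamma(\Sigma_{\pi^\star})$.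
   Context: $\mathbb S^d$ is the space of real symmetric $d\times d$ matrices, $\mathbb S_+^d$ the cone of positive semidefinite ones, and $\preceq$ the Loewner order. A representing set for $\gamma$ is a convex compact set $\mathcal K_\gamma\subset\mathbb S_+^d$ such that $\gamma(S)=\max_{Q\in\mathcal K_\gamma}\operatorname{tr}(QS)$ for every $S\succeq0$. $\mathcal P_2(\mathbb R^d)$ is the set of Borel probability measures with finite second moment and $\Pi(\mu,\nu)$ the set of couplings of $\mu$ and $\nu$. The static Spectral Wasserstein cost is $\mathsf W_\gamma(\mu,\nu)^2=\inf_{\pi\in\Pi(\mu,\nu)}\gamma\left(\int (y-x)(y-x)^\top\,d\pi(x,y)\right)$. For a symmetric matrix $Q$, $\mathsf W^Q(\mu,\nu)^2=\inf_{\pi\in\Pi(\mu,\nu)}\int (y-x)^\top Q(y-x)\,d\pi(x,y)$. Here $\gamma$ is a convex function on $\mathbb S_+^d$ (taken as $+\infty$ outside $\mathbb S_+^d$), and $\partial\gamma(\Sigma)$ is its subdifferential for the trace inner product: $Q\in\partial\gamma(\Sigma)$ iff $\gamma(T)\ge\gamma(\Sigma)+\operatorname{tr}(Q(T-\Sigma))$ for all $T\in\mathbb S_+^d$. *)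

(* Defs.v *)
From HB Require Import structures.
From mathcomp Require Import all_boot all_order all_algebra.
From mathcomp Require Import all_classical all_reals all_analysis.

Set Implicit Arguments.
Unset Strict Implicit.
Unset Printing Implicit Defensive.

Import Order.TTheory GRing.Theory Num.Theory.
Import numFieldNormedType.Exports.

Local Open Scope classical_set_scope.
Local Open Scope ring_scope.

(* R^d as column vectors, with its Borel sigma-algebra. *)
Notation euclidean R d := (g_sigma_algebraType (@open 'cV[R]_d)).

Definition is_maximum {disp} {T : porderType disp} (A : set T) (m : T) :=
  A m /\ ubound A m.

Section symmetric_matrices.
Context {R : realType} {d : nat}.
Implicit Types (A B S Q : 'M[R]_d) (gamma : 'M[R]_d -> R).

Definition psd : set 'M[R]_d :=
  [set S | S \is symmetricmx /\ forall v : 'cV[R]_d, 0 <= (v^T *m S *m v) 0 0].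

Definition loewner S S' := psd (S' - S).

(* Norms on the space of symmetric matrices are functions on all matrices
   whose values at nonsymmetric matrices are irrelevant. *)
Definition is_norm_on_sym (N : 'M[R]_d -> R) :=
  [/\ forall A, A \is symmetricmx -> N A = 0 -> A = 0,
      forall (a : R) A, A \is symmetricmx -> N (a *: A) = `|a| * N A &
      forall A B, A \is symmetricmx -> B \is symmetricmx ->
        N (A + B) <= N A + N B].

(* Likewise, gamma only matters on the positive semidefinite cone. *)
Definition psd_restriction_of_norm gamma :=
  exists2 N, is_norm_on_sym N & {in psd, gamma =1 N}.

Definition loewner_monotone gamma :=
  forall S S', psd S -> loewner S S' -> gamma S <= gamma S'.

Definition representing_set gamma (K : set 'M[R]_d) :=
  [/\ convex_set K, compact K, K `<=` psd &
      forall S, psd S -> is_maximum [set \tr (Q *m S) | Q in K] (gamma S)].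

(* As gamma is +oo outside the cone, the subdifferential is empty there. *)
Definition subdifferential gamma (Sigma : 'M[R]_d) : set 'M[R]_d :=
  [set Q | [/\ psd Sigma, Q \is symmetricmx &
    forall T, psd T -> gamma Sigma + \tr (Q *m (T - Sigma)) <= gamma T]].

End symmetric_matrices.

Section transport.
Context {R : realType} {d : nat}.
Local Notation Rd := (euclidean R d).
Implicit Types (mu nu : probability Rd R) (pi : probability (Rd * Rd)%type R).

Definition finite_second_moment mu :=
  (\int[mu]_x (((x : 'cV[R]_d)^T *m (x : 'cV[R]_d)) 0 0)%:E < +oo)%E.

Definition couplings mu nu : set (probability (Rd * Rd)%type R) :=
  [set pi | forall A : set Rd, measurable A ->
     pushforward pi fst A = mu A /\ pushforward pi snd A = nu A].

Definition displacement (z : Rd * Rd) : 'cV[R]_d :=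
  (z.2 : 'cV[R]_d) - (z.1 : 'cV[R]_d).

(* Sigma_pi; the matrix-valued integral is taken entrywise. *)
Definition second_moment_mx pi : 'M[R]_d :=
  \matrix_(i, j) \int[pi]_z (displacement z *m (displacement z)^T) i j.

Definition quad_cost (Q : 'M[R]_d) pi : \bar R :=
  \int[pi]_z (((displacement z)^T *m Q *m displacement z) 0 0)%:E.

(* The squares of the costs W_gamma and W^Q. *)
Definition spectral_wasserstein_sq (gamma : 'M[R]_d -> R) mu nu : \bar R :=
  ereal_inf [set (gamma (second_moment_mx pi))%:E | pi in couplings mu nu].

Definition quad_wasserstein_sq (Q : 'M[R]_d) mu nu : \bar R :=
  ereal_inf [set quad_cost Q pi | pi in couplings mu nu].

Definition saddle_point (K : set 'M[R]_d) mu nu (Q : 'M[R]_d) pi :=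
  [/\ K Q, couplings mu nu pi,
      forall Q', K Q' -> (quad_cost Q' pi <= quad_cost Q pi)%E &
      forall pi', couplings mu nu pi' -> (quad_cost Q pi <= quad_cost Q pi')%E].

End transport.

(* Main.v *)
Require Import Defs.
From HB Require Import structures.
From mathcomp Require Import all_boot all_order all_algebra.
From mathcomp Require Import all_classical all_reals all_analysis.
From mathcomp Require Import measurable_realfun ring lra.
Set Implicit Arguments.
Unset Strict Implicit.
Unset Printing Implicit Defensive.

Import Order.TTheory GRing.Theory Num.Theory.
Import numFieldNormedType.Exports.

Local Open Scope classical_set_scope.
Local Open Scope ring_scope.

(** By the representing set, the spectral cost is an inf-max: the infimum over
couplings [pi] of the maximum over [Q] in [K] of [\tr (Q *m Sigma_pi)]. The
theorem exchanges the two. The pairing is linear in [Q] and affine in [pi]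
along mixtures of couplings, and [K] is convex and compact, so a minimax theorem
applies whose compactness assumption is on [K] alone.

Weak duality ([weak_duality]) is [\tr (Q *m S) <= gamma S]. For the converse
([strong_duality]), let [c] be the spectral cost. Every pairing
[Q |-> \tr (Q *m Sigma_pi)] reaches the level [c] somewhere on [K], and the set
of these pairings is convex because mixtures of couplings are couplings;
[common_superlevel] then yields one [Q] in [K] at which all of them are at least
[c], that is, whose quadratic cost is at least [c] for every coupling. By
compactness,
[common_superlevel] reduces to finitely many functions
([common_superlevel_finite]); there one minimises over [K] the sum of the
squared shortfalls below [c]. If the minimum is positive, the shortfalls at the
minimiser are the weights of a convex combination of the given functions which,
by the first-order optimality condition, stays below [c] on all of [K].

At a saddle point, maximality in [Q] says that [Q] attains
[gamma (Sigma_pi)], while [\tr (Q *m T) <= gamma T] for every [T] in the cone;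
subtracting the two gives the subgradient inequality
([saddle_subgradient]). *)

(** * A minimax principle with compactness on one side *)

Section minimax.
Context {R : realType} {V : normedModType R}.
Implicit Types (K : set V) (f : V -> R) (F : set (V -> R)) (c t : R).

(** Convexity with a plain real weight, so that optimality along a segment can
be studied by varying the weight. *)
Definition convex_closed (U : lmodType R) (A : set U) :=
  forall t x y, 0 <= t <= 1 -> A x -> A y -> A (t *: x + (1 - t) *: y).

Definition affine f :=
  forall t x y, f (t *: x + (1 - t) *: y) = t * f x + (1 - t) * f y.

Lemma convex_setP (U : lmodType R) (A : set U) :
  convex_set A -> convex_closed A.
Proof.
move=> cA t x y t01 Ax Ay.
pose l : {i01 R} := Itv01 (proj1 (andP t01)) (proj2 (andP t01)).
by have := cA x y l (mem_set Ax) (mem_set Ay); rewrite inE.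
Qed.

(** Finite convex combinations from binary ones. The statement is homogeneous in
the weights, so that they need not be normalised and may all vanish. *)
Lemma nonneg_combination F : convex_closed F -> F !=set0 ->
  forall (s : seq (V -> R)) (w : (V -> R) -> R),
    (forall f, 0 <= w f) -> (forall f, f \in s -> F f) ->
  exists2 g, F g & forall x,
    \sum_(f <- s) w f * f x = (\sum_(f <- s) w f) * g x.
Proof.
move=> cF [g0 Fg0] s w w0 sF.
suff [_ [g Fg gE]] : 0 <= \sum_(f <- s) w f /\ exists2 g, F g &
    forall x, \sum_(f <- s) w f * f x = (\sum_(f <- s) w f) * g x.
  by exists g.
elim: s sF => [|f s IH] sF.
  by rewrite big_nil; split=> //; exists g0 => // x; rewrite !big_nil mul0r.
have [|L0 [g Fg gE]] := IH.
  by move=> h hs; apply: sF; rewrite inE hs orbT.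
rewrite !big_cons; split; first by rewrite addr_ge0.
set L := \sum_(h <- s) w h in L0 gE *.
have Ff : F f by apply: sF; rewrite mem_head.
have [/eqP|N0] := eqVneq (w f + L) 0.
  rewrite paddr_eq0// => /andP[/eqP wf0 /eqP LE0].
  by exists g => // x; rewrite big_cons gE wf0 LE0 !(mul0r, add0r).
have P0 : 0 < w f + L by rewrite lt_neqAle eq_sym N0 addr_ge0.
exists (w f / (w f + L) *: f + (1 - w f / (w f + L)) *: g).
  by apply: cF => //; rewrite divr_ge0 ?(ltW P0)//= ler_pdivrMr// mul1r lerDl.
move=> x; rewrite big_cons gE !fctE.
by rewrite /GRing.scale/=; field.
Qed.

(** A separation argument without a separation theorem: minimising the sum of
squared shortfalls projects onto the orthant of values at least [c], and the
shortfalls at the minimiser are the normal vector of a separating hyperplane. *)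
Lemma common_superlevel_finite F K c :
  convex_closed F -> F !=set0 -> (forall f, F f -> continuous f /\ affine f) ->
  convex_closed K -> compact K -> K !=set0 ->
  (forall f, F f -> exists2 q, K q & c <= f q) ->
  forall s : seq (V -> R), (forall f, f \in s -> F f) ->
  exists2 q, K q & forall f, f \in s -> c <= f q.
Proof.
move=> cF F0 Fcaff cK compK K0 Fc s sF.
pose gap (f : V -> R) q := Num.max 0 (c - f q).
pose psi q := \sum_(f <- s) gap f q ^+ 2.
have psi_cont : continuous psi.
  have -> : psi = fun q => \sum_(f <- s | f \in s) gap f q ^+ 2.
    by apply/funext => q; rewrite /psi big_seq.
  apply: (continuous_big add_continuous) => f fs q.
  have fq : (fun x => gap f x) @ q --> gap f q.
    apply: (@continuous_max R V (cst 0) (fun x => c - f x)).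
      exact: cvg_cst.
    by apply: cvgB; [exact: cvg_cst|exact: (proj1 (Fcaff f (sF f fs)))].
  by rewrite /continuous_at expr2; under eq_fun do rewrite expr2; exact: cvgM.
have [q0 /set_mem Kq0 q0min] :=
  compact_EVT_min K0 compK (continuous_subspaceT psi_cont).
pose w f := gap f q0.
have w0 f : 0 <= w f by rewrite /w /gap le_max lexx.
(* complementarity: the shortfall is [c - f q0] wherever it is nonzero *)
have wE f : w f * f q0 = w f * (c - w f).
  rewrite /w /gap; case: (leP 0 (c - f q0)) => h; last by rewrite !mul0r.
  by rewrite subKr.
have opt q : K q -> \sum_(f <- s) w f * (f q - f q0) <= 0.
  move=> Kq.
  (* On the segment from q0 to q the squared shortfalls are dominated by
     [(w f - t * b f) ^+ 2], with equality at t = 0; this gives a quadratic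
     upper bound on psi whose slope at 0 must be nonnegative. *)
  pose b f := f q - f q0.
  set A := \sum_(f <- s) w f * b f; pose B := \sum_(f <- s) b f ^+ 2.
  have B0 : 0 <= B by apply: sumr_ge0 => f _; rewrite sqr_ge0.
  have step t : 0 <= t <= 1 -> t * (2 * A) <= t ^+ 2 * B.
    move=> t01; have := q0min _ (mem_set (cK t q q0 t01 Kq Kq0)).
    set qt := t *: q + _.
    have -> : psi q0 = \sum_(f <- s) w f ^+ 2 by [].
    suff : psi qt <= \sum_(f <- s) (w f - t * b f) ^+ 2.
      move=> /(le_trans _) h /h {h}.
      have -> : \sum_(f <- s) (w f - t * b f) ^+ 2 =
          \sum_(f <- s) w f ^+ 2 - t * (2 * A) + t ^+ 2 * B.
        rewrite /A /B !mulr_sumr -sumrB -big_split/=.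
        by apply: eq_bigr => f _; ring.
      lra.
    rewrite /psi !big_seq; apply: ler_sum => f fs.
    have -> : gap f qt = Num.max 0 (c - f q0 - t * b f).
      by rewrite /gap /qt (proj2 (Fcaff f (sF f fs))) /b; congr Num.max; ring.
    rewrite /w /gap; set a := c - f q0; set y := t * b f.
    case: (leP 0 a) => ha; case: (leP 0 (a - y)) => hy.
    - exact: lexx.
    - by rewrite expr0n sqr_ge0.
    - by nra.
    - by rewrite expr0n sqr_ge0.
  (* Any weight t > 0 with t * B < 2 * A refutes A > 0; A / (A + B) is one,
     even if B = 0. *)
  rewrite leNgt; apply/negP => A0.
  have t01 : 0 <= A / (A + B) <= 1.
    rewrite divr_ge0 ?addr_ge0 ?(ltW A0)//= ler_pdivrMr ?ltr_wpDr//.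
    by rewrite mul1r lerDl.
  have AB0 : 0 < A + B by rewrite ltr_wpDr.
  have /= := step _ t01; set t := A / (A + B).
  have t0 : 0 < t by rewrite divr_gt0.
  rewrite expr2 -mulrA ler_pM2l// leNgt => /negP; apply.
  rewrite /t mulrAC ltr_pdivrMr//.
  by nra.
exists q0 => // f fs.
rewrite leNgt; apply/negP => fq0.
have [g Fg gE] := nonneg_combination cF F0 w0 sF.
have wf0 : 0 < w f by rewrite /w /gap lt_max subr_gt0 fq0 orbT.
set L := \sum_(h <- s) w h in gE.
have L0 : 0 < L.
  rewrite /L (big_rem f)//= ltr_pwDl//; exact: sumr_ge0.
have [q Kq cq] := Fc g Fg.
suff : L * g q < L * c by rewrite ltr_pM2l// ltNge cq.
(* optimality moves the bound from q to q0, where complementarity applies *)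
have : L * g q <= \sum_(h <- s) w h * h q0.
  rewrite -subr_le0 -gE -sumrB; apply: le_trans (opt q Kq).
  by under eq_bigr do rewrite -mulrBr.
move=> /le_lt_trans; apply.
rewrite (eq_bigr _ (fun h _ => wE h)) /L mulr_suml -subr_gt0 -sumrB.
under eq_bigr do rewrite -mulrBr subKr.
rewrite (big_rem f)//= ltr_pwDl//; first exact: mulr_gt0.
by apply: sumr_ge0 => h _; rewrite mulr_ge0.
Qed.

(** If no point of [K] works, the open sets [f < c] cover [K]; a finite subcover
contradicts the finite case. *)
Lemma common_superlevel F K c :
  convex_closed F -> (forall f, F f -> continuous f /\ affine f) ->
  convex_closed K -> compact K -> K !=set0 ->
  (forall f, F f -> exists2 q, K q & c <= f q) ->
  exists2 q, K q & forall f, F f -> c <= f q.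
Proof.
move=> cF Fcaff cK compK K0 Fc.
have [F0|/set0P/negP/negPn/eqP F0] := pselect (F !=set0); last first.
  by case: K0 => q Kq; exists q => // f; rewrite F0.
apply: contrapT => none.
move: (compK); rewrite compact_cover.
move=> /(_ (V -> R) F (fun f => [set q | f q < c])) [|q Kq|D' D'F D'cov].
- move=> f Ff; rewrite (_ : [set q | _] = f @^-1` [set y | y < c])//.
  by apply: open_comp; [move=> q _; exact: (proj1 (Fcaff f Ff))|exact: open_lt].
- apply: contrapT => nq; apply: none; exists q => // f Ff.
  by rewrite leNgt; apply/negP => fq; apply: nq; exists f.
have [|q Kq qs] := common_superlevel_finite cF F0 Fcaff cK compK K0 Fc
  (s := finmap.enum_fset D').
  by move=> f fD; apply: set_mem; exact: D'F.
by have [f fD] := D'cov q Kq; rewrite /= ltNge qs.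
Qed.

End minimax.

(** * Mixtures of two probability measures *)

Section mixture.
Context {disp : measure_display} {T : measurableType disp} {R : realType}.
Context (t : {i01 R}) (p q : probability T R).

Definition mixture : set T -> \bar R :=
  measure_add (mscale t%:num%:nng p) (mscale (1 - t%:num)%:nng q).

HB.instance Definition _ := Measure.on mixture.

Lemma mixtureE A : mixture A = (t%:num%:E * p A + (1 - t%:num)%:E * q A)%E.
Proof. by rewrite /mixture measure_addE. Qed.

Let mixture_setT : mixture setT = 1%E.
Proof. by rewrite mixtureE !probability_setT !mule1 -EFinD addrC subrK. Qed.

HB.instance Definition _ :=
  Measure_isProbability.Build _ _ _ mixture mixture_setT.

Lemma ge0_integral_mixture (f : T -> \bar R) :
  measurable_fun [set: T] f -> (forall x, 0 <= f x)%E ->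
  (\int[mixture]_x f x =
   t%:num%:E * \int[p]_x f x + (1 - t%:num)%:E * \int[q]_x f x)%E.
Proof.
by move=> mf f0; rewrite ge0_integral_measure_add// !ge0_integral_mscale.
Qed.

Lemma Rintegral_mixture (f : T -> R) :
  p.-integrable setT (EFin \o f) -> q.-integrable setT (EFin \o f) ->
  \int[mixture]_x f x =
    t%:num * \int[p]_x f x + (1 - t%:num) * \int[q]_x f x.
Proof.
move=> pf qf; have mf := measurable_int _ pf.
rewrite /Rintegral !(integralE _ _ (EFin \o f)).
rewrite !ge0_integral_mixture//; last 2 first.
  exact: measurable_funeneg.
  exact: measurable_funepos.
have mT : measurable [set: T] by [].
have := integrable_pos_fin_num mT pf; have := integrable_neg_fin_num mT pf.
have := integrable_pos_fin_num mT qf; have := integrable_neg_fin_num mT qf.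
do 4 move=> /fineK <-.
by rewrite -!EFinM -!EFinD/=; ring.
Qed.

End mixture.

(** * Second moments of couplings *)

Section couplings.
Context {R : realType} {d : nat}.
Local Notation Rd := (euclidean R d).
Implicit Types (mu nu : probability Rd R) (pi : probability (Rd * Rd)%type R).
Implicit Types (Q : 'M[R]_d) (i j : 'I_d).

Lemma measurable_coord i :
  measurable_fun [set: Rd] (fun x : Rd => (x : 'cV[R]_d) i 0).
Proof.
apply: (measurability _ (RGenOpens.measurableE R)).
move=> _ [_ [a [b ->] <-]]; rewrite setTI; apply: sub_sigma_algebra.
by apply: open_comp; [move=> ? _; exact: coord_continuous|exact: interval_open].
Qed.

Lemma measurable_displacement i :
  measurable_fun [set: Rd * Rd] (fun z => displacement z i 0).
Proof.
rewrite (_ : (fun z => _) =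
    (fun z : Rd * Rd => (z.2 : 'cV[R]_d) i 0 - (z.1 : 'cV[R]_d) i 0)).
  by apply: measurable_funB; [
    exact: (measurableT_comp (measurable_coord i) measurable_snd)|
    exact: (measurableT_comp (measurable_coord i) measurable_fst)].
by apply/funext => z; rewrite /displacement !mxE.
Qed.

Lemma outer_productE (v : 'cV[R]_d) i j : (v *m v^T) i j = v i 0 * v j 0.
Proof. by rewrite mxE big_ord1 mxE. Qed.

Lemma sqr_coord_le (x : 'cV[R]_d) i : x i 0 ^+ 2 <= (x^T *m x) 0 0.
Proof.
rewrite mxE (bigD1 i)//= mxE -expr2 lerDl.
by apply: sumr_ge0 => k _; rewrite mxE -expr2 sqr_ge0.
Qed.

Lemma integrable_sqr_coord mu i : finite_second_moment mu ->
  mu.-integrable [set: Rd] (fun x : Rd => ((x : 'cV[R]_d) i 0 ^+ 2)%:E).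
Proof.
move=> mu2; apply/integrableP.
have mi := measurable_coord i.
split; first by apply/measurable_EFinP; exact: measurable_funX.
apply: le_lt_trans mu2; apply: ge0_le_integral => //.
- apply: measurableT_comp => //; apply/measurable_EFinP.
  exact: measurable_funX.
- apply/measurable_EFinP.
  rewrite (_ : (fun x => _) = fun x : Rd => \sum_k (x : 'cV[R]_d) k 0 ^+ 2).
    apply: measurable_sum => k; apply: measurable_funX.
    exact: measurable_coord.
  by apply/funext => x; rewrite mxE; apply: eq_bigr => k _; rewrite mxE expr2.
- by move=> x _; rewrite lee_fin ger0_norm ?sqr_ge0// sqr_coord_le.
Qed.

(** Only the values of the image measure on measurable sets are known, which is
enough since integrals depend on nothing else. *)
Lemma integrable_marginal mu pi (phi : Rd * Rd -> Rd) (f : Rd -> \bar R) :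
  measurable_fun [set: Rd * Rd] phi ->
  (forall A : set Rd, measurable A -> pushforward pi phi A = mu A) ->
  mu.-integrable [set: Rd] f -> pi.-integrable [set: Rd * Rd] (f \o phi).
Proof.
move=> mphi margin /integrableP[mf foo]; apply/integrableP.
split; first exact: measurableT_comp.
rewrite -[X in (X < _)%E]/(\int[pi]_(z in phi @^-1` setT)
  ((abse \o f) \o phi) z)%E.
rewrite -ge0_integral_pushforward//; last 2 first.
- exact: measurableT_comp.
- by move=> x _ /=; exact: abse_ge0.
rewrite (eq_measure_integral mu)// => A mA _; exact: margin.
Qed.

(** Each product of two coordinates of [y - x] is bounded by the squares of the
same coordinates of [x] and [y], which depend on one marginal each. Hence all
entries of the second moment matrix are genuine integrals. *)
Lemma integrable_displacement mu nu pi i j :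
  finite_second_moment mu -> finite_second_moment nu -> couplings mu nu pi ->
  pi.-integrable [set: Rd * Rd]
    (EFin \o fun z => (displacement z *m (displacement z)^T) i j).
Proof.
move=> mu2 nu2 cpl.
have fstI k : pi.-integrable [set: Rd * Rd]
    (fun z => ((z.1 : 'cV[R]_d) k 0 ^+ 2)%:E).
  apply: (@integrable_marginal mu pi fst _ measurable_fst)
    (integrable_sqr_coord k mu2).
  by move=> A /cpl[].
have sndI k : pi.-integrable [set: Rd * Rd]
    (fun z => ((z.2 : 'cV[R]_d) k 0 ^+ 2)%:E).
  apply: (@integrable_marginal nu pi snd _ measurable_snd)
    (integrable_sqr_coord k nu2).
  by move=> A /cpl[].
have mT : measurable [set: Rd * Rd] by [].
have bound := integrableD mT
  (integrableD mT (fstI i) (sndI i)) (integrableD mT (fstI j) (sndI j)).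
apply: (@le_integrable _ _ _ _ _ mT _ _ _ _ bound) => [|z _ /=].
  apply/measurable_EFinP; under eq_fun do rewrite outer_productE.
  by apply: measurable_funM; exact: measurable_displacement.
rewrite outer_productE lee_fin [leRHS]ger0_norm; last first.
  by rewrite !addr_ge0 ?sqr_ge0.
rewrite ler_norml /displacement !mxE.
set a := (z.1 : 'cV[R]_d) i 0; set b := (z.2 : 'cV[R]_d) i 0.
set x := (z.1 : 'cV[R]_d) j 0; set y := (z.2 : 'cV[R]_d) j 0.
(* 2 (a^2 + b^2 + x^2 + y^2) -+ 2 (b - a) (y - x) is the sum of these squares,
   with one of the first two *)
have := sqr_ge0 ((b - a) + (y - x)); have := sqr_ge0 ((b - a) - (y - x)).
have := sqr_ge0 (a + b); have := sqr_ge0 (x + y).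
by move=> *; apply/andP; split; nra.
Qed.

Lemma mxtrace_mulE (A B : 'M[R]_d) :
  \tr (A *m B) = \sum_p A p.1 p.2 * B p.2 p.1.
Proof.
rewrite /mxtrace -(pair_bigA _ (fun i j => A i j * B j i))/=.
by apply: eq_bigr => i _; rewrite mxE.
Qed.

Lemma quad_form_trace Q (v : 'cV[R]_d) :
  (v^T *m Q *m v) 0 0 = \tr (Q *m (v *m v^T)).
Proof. by rewrite -trace_mx11 -mulmxA mxtrace_mulC mulmxA. Qed.

(** This makes the cost linear in [Q] and finite, and lets it depend on [pi]
only through a matrix. *)
Lemma quad_costE mu nu pi Q :
  finite_second_moment mu -> finite_second_moment nu -> couplings mu nu pi ->
  quad_cost Q pi = (\tr (Q *m second_moment_mx pi))%:E.
Proof.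
move=> mu2 nu2 cpl; have DI i j := integrable_displacement i j mu2 nu2 cpl.
have mT : measurable [set: Rd * Rd] by [].
rewrite /quad_cost; under eq_integral do
  rewrite quad_form_trace mxtrace_mulE -sumEFin.
rewrite integral_sum//; last first.
  move=> p; under eq_fun do rewrite EFinM; exact: (integrableZl mT _ (DI _ _)).
rewrite mxtrace_mulE -sumEFin; apply: eq_bigr => p _.
under eq_integral do rewrite EFinM.
rewrite (integralZl mT (DI _ _)) mxE EFinM /Rintegral fineK//.
exact: (integrable_fin_num mT (DI _ _)).
Qed.

Lemma psd_second_moment_mx mu nu pi :
  finite_second_moment mu -> finite_second_moment nu -> couplings mu nu pi ->
  psd (second_moment_mx pi).
Proof.
move=> mu2 nu2 cpl; split.
  apply/is_hermitianmxP; rewrite expr0 scale1r; apply/matrixP => i j.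
  rewrite !mxE; apply: eq_Rintegral => z _.
  by rewrite !outer_productE mulrC.
(* the quadratic form at v is the cost of the rank-one matrix v v^T *)
move=> v; rewrite quad_form_trace mxtrace_mulC -lee_fin.
rewrite -(quad_costE _ mu2 nu2 cpl); apply: integral_ge0 => z _.
rewrite lee_fin !mulmxA -mulmxA.
have -> : (displacement z)^T *m v = (v^T *m displacement z)^T.
  by rewrite trmx_mul trmxK.
by rewrite mxE big_ord1 mxE -expr2 sqr_ge0.
Qed.

Lemma couplings_mixture mu nu p q (t : {i01 R}) :
  couplings mu nu p -> couplings mu nu q -> couplings mu nu (mixture t p q).
Proof.
move=> cp cq A mA.
have [p1 p2] := cp A mA; have [q1 q2] := cq A mA.
have avg (m : probability Rd R) :
    (t%:num%:E * m A + (1 - t%:num)%:E * m A = m A)%E.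
  rewrite -muleDl//; first by rewrite -EFinD addrC subrK mul1e.
  exact: fin_num_measure.
split; rewrite [LHS]mixtureE.
  by rewrite -[RHS]avg -{1}p1 -q1.
by rewrite -[RHS]avg -{1}p2 -q2.
Qed.

Lemma second_moment_mx_mixture mu nu p q (t : {i01 R}) :
  finite_second_moment mu -> finite_second_moment nu ->
  couplings mu nu p -> couplings mu nu q ->
  second_moment_mx (mixture t p q) =
    t%:num *: second_moment_mx p + (1 - t%:num) *: second_moment_mx q.
Proof.
move=> mu2 nu2 cp cq; apply/matrixP => i j; rewrite !mxE.
apply: Rintegral_mixture.
  exact: (integrable_displacement _ _ mu2 nu2 cp).
exact: (integrable_displacement _ _ mu2 nu2 cq).
Qed.

End couplings.

(** * Duality and saddle points *)

Section duality.
Context {R : realType} {d : nat}.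
Context (gamma : 'M[R]_d -> R) (K : set 'M[R]_d).
Hypothesis repr : representing_set gamma K.
Context (mu nu : probability (euclidean R d) R).
Hypotheses (mu2 : finite_second_moment mu) (nu2 : finite_second_moment nu).

Lemma trace_le_gauge Q S : K Q -> psd S -> \tr (Q *m S) <= gamma S.
Proof. by case: repr => _ _ _ gK KQ /gK[_]; apply; exists Q. Qed.

Lemma gauge_attained S : psd S -> exists2 Q, K Q & \tr (Q *m S) = gamma S.
Proof. by case: repr => _ _ _ gK /gK[]. Qed.

Lemma representing_set_neq0 : K !=set0.
Proof.
have [|Q KQ _] := @gauge_attained 0; last by exists Q.
split; first by apply/is_hermitianmxP; rewrite trmx0 map_mx0 scaler0.
by move=> v; rewrite mulmx0 mul0mx mxE.
Qed.

Lemma weak_duality Q : K Q ->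
  (quad_wasserstein_sq Q mu nu <= spectral_wasserstein_sq gamma mu nu)%E.
Proof.
move=> KQ; apply: le_ereal_inf_tmp => _ [pi cpl <-].
apply: ge_ereal_inf; exists (quad_cost Q pi); first by exists pi.
rewrite (quad_costE Q mu2 nu2 cpl) lee_fin trace_le_gauge//.
exact: (psd_second_moment_mx mu2 nu2 cpl).
Qed.

Definition trace_pairing (S Q : 'M[R]_d) := \tr (Q *m S).

Lemma continuous_trace_pairing S : continuous (trace_pairing S).
Proof.
have -> : trace_pairing S = fun Q => \sum_p Q p.1 p.2 * S p.2 p.1.
  by apply/funext => Q; exact: mxtrace_mulE.
apply: (continuous_big add_continuous) => p _ Q.
by apply: continuousM; [exact: coord_continuous|exact: cst_continuous].
Qed.

Lemma affine_trace_pairing S : affine (trace_pairing S).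
Proof.
by move=> t P Q; rewrite /trace_pairing mulmxDl -!scalemxAl mxtraceD !mxtraceZ.
Qed.

Lemma convex_coupling_pairings : convex_closed
  [set trace_pairing (second_moment_mx pi) | pi in couplings mu nu].
Proof.
move=> t _ _ /andP[t0 t1] [p cp <-] [q cq <-].
pose u : {i01 R} := Itv01 t0 t1.
exists (mixture u p q); first exact: couplings_mixture.
rewrite (second_moment_mx_mixture _ mu2 nu2 cp cq); apply/funext => Q.
by rewrite /trace_pairing !fctE mulmxDr -!scalemxAr mxtraceD !mxtraceZ.
Qed.

(** The infinite values are treated apart: at [-oo] weak duality suffices, and
at [+oo] there is no coupling, so that every infimum is over the empty set. *)
Lemma strong_duality : exists2 Q, K Q &
  quad_wasserstein_sq Q mu nu = spectral_wasserstein_sq gamma mu nu.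
Proof.
have [cK compK _ _] := repr; have [Q0 KQ0] := representing_set_neq0.
have inf_le pi : couplings mu nu pi ->
    (spectral_wasserstein_sq gamma mu nu <= (gamma (second_moment_mx pi))%:E)%E.
  by move=> cpl; apply: ereal_inf_lbound; exists pi.
case E : (spectral_wasserstein_sq gamma mu nu) => [c| |]; last first.
- exists Q0 => //; apply/eqP; rewrite -leeNy_eq -E; exact: weak_duality.
- exists Q0 => //; apply/eqP; rewrite -leye_eq.
  apply: le_ereal_inf_tmp => _ [pi cpl <-].
  by have := inf_le pi cpl; rewrite E leye_eq.
have [f [pi cpl <-]|_ [pi cpl <-]|Q KQ Qc] := common_superlevel (c := c)
    convex_coupling_pairings _ (convex_setP cK) compK representing_set_neq0.
- by split; [exact: continuous_trace_pairing|exact: affine_trace_pairing].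
- have [Q KQ QE] := gauge_attained (psd_second_moment_mx mu2 nu2 cpl).
  by exists Q => //; rewrite /trace_pairing QE -lee_fin -E inf_le.
exists Q => //; apply/eqP; rewrite eq_le -{1}E weak_duality//=.
apply: le_ereal_inf_tmp => _ [pi cpl <-].
rewrite (quad_costE Q mu2 nu2 cpl) lee_fin.
by apply: (Qc (trace_pairing _)); exists pi.
Qed.

Lemma saddle_subgradient Q pi :
  saddle_point K mu nu Q pi -> subdifferential gamma (second_moment_mx pi) Q.
Proof.
case=> KQ cpl Qmax _; have [_ _ Kpsd _] := repr.
have Spsd := psd_second_moment_mx mu2 nu2 cpl.
split=> //; first by case: (Kpsd Q KQ).
move=> T Tpsd.
have [Q' KQ' <-] := gauge_attained Spsd.
have := Qmax Q' KQ'; rewrite !(quad_costE _ mu2 nu2 cpl) lee_fin => Q'Q.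
rewrite mulmxBr linearB/= addrCA.
by have := trace_le_gauge KQ Tpsd; lra.
Qed.

End duality.

Theorem theorem3p3 (R : realType) (d : nat)
    (gamma : 'M[R]_d -> R) (K : set 'M[R]_d) :
  psd_restriction_of_norm gamma ->
  loewner_monotone gamma ->
  representing_set gamma K ->
  forall mu nu : probability (euclidean R d) R,
  finite_second_moment mu -> finite_second_moment nu ->
  [/\ is_maximum
        [set ereal_inf
               [set (\int[pi]_z
                      (((displacement z)^T *m Q *m displacement z) 0 0)%:E)%E
                 | pi in couplings mu nu]
          | Q in K]
        (spectral_wasserstein_sq gamma mu nu),
      is_maximum [set quad_wasserstein_sq Q mu nu | Q in K]
        (spectral_wasserstein_sq gamma mu nu) &
      forall (Q : 'M[R]_d) (pi : probability (euclidean R d * euclidean R d)%type R),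
        saddle_point K mu nu Q pi ->
        subdifferential gamma (second_moment_mx pi) Q].
Proof.
move=> _ _ repr mu nu mu2 nu2.
suff dual : is_maximum [set quad_wasserstein_sq Q mu nu | Q in K]
    (spectral_wasserstein_sq gamma mu nu).
  by split=> // Q pi; exact: (saddle_subgradient repr mu2 nu2).
split; last by move=> _ [Q KQ <-]; exact: (weak_duality repr mu2 nu2).
by have [Q KQ QE] := strong_duality repr mu2 nu2; exists Q.
Qed.
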